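(* Let $X$ be a set. (1) For every set-represented line structure $L=(Y,\in)$ on $X$, the ternary relation $\iota(L)=\langle\cdot,\cdot,\cdot\rangle_L$ on $X$ defined by $$\langle a,b,c\rangle_L :\Longleftrightarrow \bigl(a\neq c \text{ and } b\in\overleftrightarrow{ac}\bigr)\ \text{or}\ \bigl(a=c\text{ and } b\in\{a\}\bigr)$$ is an equivalence-relational join relation on $X$. (2) Vice versa, for every equivalence-relational join relation $\langle\cdot,\cdot,\cdot\rangle$ on $X$, the pair $\lambda(\langle\cdot,\cdot,\cdot\rangle):=(Y,\in)$ with $Y:=\{ab \mid a,b\in X,\ a\neq b\}$ and $\in$ set membership is a set-represented line structure on $X$. (3) $(\iota,\lambda)$ is an inverse pair of one-to-one correspondences between the set-represented line structures on $X$ and the equivalence-relational join relations on $X$. (4) Under this correspondence, set-represented projective line structures on $X$ correspond to projective join relations on $X$.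
   Context: A line structure on a set $X$ is a pair $(Y,* )$ where $Y$ is a set and $*\subseteq X\times Y$ is a binary relation such that: (i) for $a,b\in X$ with $a\ne b$ there is exactly one $y\in Y$ with $a*y$ and $b*y$; this $y$ is denoted $\overleftrightarrow{ab}$; (ii) for every $y\in Y$ there are two different $a,b\in X$ with $a*y$, $b*y$. It is set-represented iff $Y$ is a set of subsets of $X$ and $*$ is set membership $\in$. A join relation on a set $X$ is a ternary relation $\langle\cdot,\cdot,\cdot\rangle$ on $X$ such that: $\langle a,x,x\rangle$ for all $a,x\in X$; $\langle x,b,y\rangle$ implies $\langle y,b,x\rangle$ for all $x,b,y\in X$; and $\langle x,y,x\rangle$ implies $y=x$ for all $x,y\in X$. For $a,c\in X$ put $ac:=\{x\in X\mid \langle a,x,c\rangle\}$. A join relation is transitive iff for all $a,b,c\in X$, $\langle a,b,c\rangle$ implies $ab\subseteq ac$. It is symmetric iff for all $a,b,c\in X$, $\langle a,b,c\rangle$ and $a\neq b$ imply $\langle a,c,b\rangle$. It is equivalence-relational iff it is transitive and symmetric. A join relation is preprojective iff it is equivalence-relational and for all $a,b,c,d\in X$: if $b=c$ or $a=d$ or $bc\cap ad\neq\emptyset$, then $a=b$ or $c=d$ or $ab\cap cd\neq\emptyset$. It is dense iff for all $a,b\in X$ with $a\neq b$, $ab\setminus\{a,b\}\neq\emptyset$. It is projective iff it is preprojective and dense. A line structure on $X$ is called projective iff its associated join relation is projective; for a set-represented line structure $L$, the associated join relation is the relation $\langle\cdot,\cdot,\cdot\rangle_L$ defined in (1). *)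

(* Defs.v *)
From mathcomp Require Import all_boot.
From mathcomp Require Import boolp classical_sets functions.

Set Implicit Arguments.
Unset Strict Implicit.
Unset Printing Implicit Defensive.

Local Open Scope classical_set_scope.

(* The set of lines is a subset Y of an ambient type T; only the restriction
   of inc to pairs (x, y) with y in Y matters. *)
Definition line_structure (X T : Type) (Y : set T) (inc : X -> T -> Prop) : Prop :=
  (forall a b : X, a <> b -> exists! y, Y y /\ inc a y /\ inc b y) /\
  (forall y, Y y -> exists a b : X, a <> b /\ inc a y /\ inc b y).

(* A set-represented line structure (Y, \in) is determined by Y, and is
   identified with it. *)
Definition set_line_structure (X : Type) (L : set (set X)) : Prop :=
  line_structure L (fun (x : X) (y : set X) => y x).

(* The line through a and b.  The default value set0 is never used when L is a
   set-represented line structure and a <> b. *)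
Definition line_through (X : Type) (L : set (set X)) (a b : X) : set X :=
  xget set0 [set y | L y /\ y a /\ y b].

Definition ternary (X : Type) := X -> X -> X -> Prop.

Definition join_relation (X : Type) (J : ternary X) : Prop :=
  [/\ forall a x, J a x x,
      forall x b y, J x b y -> J y b x &
      forall x y, J x y x -> y = x].

Definition seg (X : Type) (J : ternary X) (a c : X) : set X := [set x | J a x c].

Definition join_transitive (X : Type) (J : ternary X) : Prop :=
  forall a b c, J a b c -> seg J a b `<=` seg J a c.

Definition join_symmetric (X : Type) (J : ternary X) : Prop :=
  forall a b c, J a b c -> a <> b -> J a c b.

Definition equivalence_relational (X : Type) (J : ternary X) : Prop :=
  [/\ join_relation J, join_transitive J & join_symmetric J].

Definition preprojective (X : Type) (J : ternary X) : Prop :=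
  equivalence_relational J /\
  forall a b c d,
    b = c \/ a = d \/ seg J b c `&` seg J a d !=set0 ->
    a = b \/ c = d \/ seg J a b `&` seg J c d !=set0.

Definition join_dense (X : Type) (J : ternary X) : Prop :=
  forall a b, a <> b -> seg J a b `\` [set a; b] !=set0.

Definition projective (X : Type) (J : ternary X) : Prop :=
  preprojective J /\ join_dense J.

Definition iota_join (X : Type) (L : set (set X)) : ternary X :=
  fun a b c => (a <> c /\ line_through L a c b) \/ (a = c /\ [set a] b).

Definition lambda_lines (X : Type) (J : ternary X) : set (set X) :=
  [set y | exists a b, a <> b /\ y = seg J a b].

Definition projective_set_line_structure (X : Type) (L : set (set X)) : Prop :=
  set_line_structure L /\ projective (iota_join L).

(* Main.v *)
(* The key fact is that in an equivalence-relational join relation any two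
   distinct points p, q of ab satisfy pq = ab.  If, say, p <> a, then
   transitivity and symmetry give ap = ab, so q lies in pa, and the same
   argument based at p gives pq = pa.  Hence the sets ab with a <> b are the
   lines of a line structure, and the line through a and b is ab itself. *)
Require Import Defs.
From mathcomp Require Import all_boot.
From mathcomp Require Import boolp classical_sets functions.

Set Implicit Arguments.
Unset Strict Implicit.

Local Open Scope classical_set_scope.

Section EquivalenceRelational.
Variables (X : Type) (J : ternary X).
Hypothesis Jeq : equivalence_relational J.

Let Jr a x : J a x x. Proof. by case: Jeq => -[]. Qed.
Let Jl a x : J a a x. Proof. by case: Jeq => -[? + _] _ _; apply. Qed.

Lemma seg_xx a : seg J a a = [set a].
Proof.
by case: Jeq => -[_ _ J1] _ _; apply/seteqP; split=> x; [exact: J1 | move->].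
Qed.

Lemma segC a b : seg J a b = seg J b a.
Proof. by case: Jeq => -[_ JC _] _ _; apply/seteqP; split=> x; apply: JC. Qed.

(** Transitivity gives one inclusion. As [a <> b], symmetry exchanges [b] and [c], and transitivity
    then gives the other. *)
Lemma seg_eql a b c : seg J a c b -> a <> b -> seg J a b = seg J a c.
Proof.
case: Jeq => _ Jt Js Jabc ab.
by apply/seteqP; split; apply: (Jt _ _ _) => //; apply: Js.
Qed.

Lemma seg_eq a b p q :
  seg J a b p -> seg J a b q -> p <> q -> seg J p q = seg J a b.
Proof.
move=> abp abq pq; have [ap|ap] := pselect (a = p).
  by rewrite -ap in pq *; apply: seg_eql.
have apb := seg_eql abp ap.
by rewrite -apb segC in abq *; apply: seg_eql.
Qed.

Lemma lambda_lines_structure : set_line_structure (lambda_lines J).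
Proof.
split=> [a b ab|_ [a [b [ab ->]]]]; last first.
  by exists a, b; split=> //; split; [exact: Jl | exact: Jr].
exists (seg J a b); split=> [|y [[c [d [_ yE]]] [cda cdb]]].
  by split; [exists a, b | split; [exact: Jl | exact: Jr]].
(* Uniqueness: any line [seg J c d] through [a] and [b] is [seg J a b]. *)
by rewrite yE in cda cdb *; apply: seg_eq.
Qed.

End EquivalenceRelational.

Section SetLineStructure.
Variables (X : Type) (L : set (set X)).
Hypothesis Lls : set_line_structure L.

Lemma line_throughP a b : a <> b ->
  [/\ L (line_through L a b), line_through L a b a & line_through L a b b].
Proof.
case: Lls => Lu _ ab; have [y [Ly _]] := Lu _ _ ab.
(* [xget] returns either a line through both points or the default [set0]; the latter would mean
   that no such line exists, against [y]. *)
by rewrite /line_through; case: xgetP => [z _ [? []] //|/(_ y)].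
Qed.

Lemma line_through_eq a b y : a <> b -> L y -> y a -> y b ->
  line_through L a b = y.
Proof.
case: (Lls) => Lu _ ab Ly ya yb; have [z [_ zu]] := Lu _ _ ab.
by have [? ? ?] := line_throughP ab; rewrite -(zu y) // -(zu (line_through L a b)).
Qed.

Lemma line_through_sub a b p q : a <> b -> p <> q ->
  line_through L a b p -> line_through L a b q ->
  line_through L p q = line_through L a b.
Proof. by move=> /line_throughP[? _ _] pq ? ?; apply: line_through_eq. Qed.

(** Both sides choose from the same set of lines, and [xget] depends only on that set and the
    default. *)
Lemma line_throughC a b : line_through L a b = line_through L b a.
Proof.
by rewrite /line_through; congr xget; apply/seteqP; split=> y /= [? []].
Qed.

Lemma seg_iota_join a b : a <> b ->
  seg (iota_join L) a b = line_through L a b.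
Proof.
move=> ab; apply/seteqP; split=> x; last by left.
by case=> -[].
Qed.

(** Transitivity and symmetry both rest on one fact: if [b] lies on the line through [a] and [c] and
    [b] is not [a], then the line through [a] and [b] is that same line. *)
Lemma iota_join_equivalence : equivalence_relational (iota_join L).
Proof.
split; first split.
- move=> a x; have [->|ax] := pselect (a = x); first by right.
  by left; split=> //; have [] := line_throughP ax.
- move=> x b y [[xy xyb]|[-> ->]]; last by right.
  by left; split; [exact: nesym | rewrite line_throughC].
- by move=> x y [[]|[]].
- move=> a b c [[ac acb]|[<- ->]] x //.
  have [_ aca _] := line_throughP ac.
  move=> [[ab abx]|[_ ->]]; left; split=> //.
  by rewrite -(line_through_sub ac ab).
- move=> a b c [[ac acb]|[_ ->]] // ab; left; split=> //.
  by have [_ aca acc] := line_throughP ac; rewrite (line_through_sub ac ab).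
Qed.

(** Each segment with distinct ends is a line; conversely, a line has two distinct points and, by
    uniqueness, is the line through them. *)
Lemma iota_joinK : lambda_lines (iota_join L) = L.
Proof.
apply/seteqP; split=> [_ [a [b [ab ->]]]|y Ly].
  by rewrite seg_iota_join //; have [] := line_throughP ab.
have [a [b [ab [ya yb]]]] := proj2 Lls _ Ly.
by exists a, b; split=> //; rewrite seg_iota_join // (line_through_eq ab Ly).
Qed.

End SetLineStructure.

(** A join relation is determined by its segments. For [a = c] both segments are the singleton of
    [a]; otherwise [seg J a c] is itself a line through [a] and [c], hence the only one. *)
Lemma lambda_linesK (X : Type) (J : ternary X) :
  equivalence_relational J -> iota_join (lambda_lines J) = J.
Proof.
move=> Jeq; have Ll := lambda_lines_structure Jeq.
have E a c : seg (iota_join (lambda_lines J)) a c = seg J a c.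
  have [<-|ac] := pselect (a = c).
    by rewrite !seg_xx //; apply: iota_join_equivalence.
  have [[Jr JC _] _ _] := Jeq.
  rewrite seg_iota_join //; apply: line_through_eq => //; first by exists a, c.
  exact/JC/Jr.
apply/funext => a; apply/funext => b; apply/funext => c.
exact: (congr1 (@^~ b) (E a c)).
Qed.

(** The inverse laws are required only on [A] and [B], as [iota_join] and [lambda_lines] are shown
    to cancel only on genuine structures. *)
Lemma set_bij_can2 (S T : Type) (A : set S) (B : set T)
    (f : S -> T) (g : T -> S) :
  (forall x, A x -> B (f x)) -> (forall y, B y -> A (g y)) ->
  (forall x, A x -> g (f x) = x) -> (forall y, B y -> f (g y) = y) ->
  set_bij A B f.
Proof.
move=> AB BA fK gK; split=> // [x y /set_mem Ax /set_mem Ay fxy|y By].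
  by rewrite -(fK x) // fxy fK.
by exists (g y); [exact: BA | exact: gK].
Qed.

Theorem theorem4p1 (X : Type) :
  [/\ (* (1) *)
      forall L : set (set X),
        set_line_structure L -> equivalence_relational (iota_join L),
      (* (2) *)
      forall J : ternary X,
        equivalence_relational J -> set_line_structure (lambda_lines J),
      (* (3) *)
      [/\ set_bij [set L : set (set X) | set_line_structure L]
                  [set J : ternary X | equivalence_relational J]
                  (@iota_join X),
          set_bij [set J : ternary X | equivalence_relational J]
                  [set L : set (set X) | set_line_structure L]
                  (@lambda_lines X),
          forall L : set (set X),
            set_line_structure L -> lambda_lines (iota_join L) = L &
          forall J : ternary X,
            equivalence_relational J -> iota_join (lambda_lines J) = J] &
      (* (4) *)
      set_bij [set L : set (set X) | projective_set_line_structure L]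
              [set J : ternary X | projective J]
              (@iota_join X) /\
      set_bij [set J : ternary X | projective J]
              [set L : set (set X) | projective_set_line_structure L]
              (@lambda_lines X)].
Proof.
(* Projectivity of a line structure is that of its join relation, and the join relation of
   [lambda_lines J] is [J] again. *)
have lines_proj J : projective J -> projective_set_line_structure (@lambda_lines X J).
  move=> Jp; have [[Jeq _] _] := Jp.
  by split; [exact: lambda_lines_structure | rewrite lambda_linesK].
have projK J : projective J -> iota_join (@lambda_lines X J) = J.
  by move=> [[Jeq _] _]; apply: lambda_linesK.
split; [exact: iota_join_equivalence|exact: lambda_lines_structure|split|split].
- apply: (set_bij_can2 (g := @lambda_lines X)).
  + exact: iota_join_equivalence.
  + exact: lambda_lines_structure.
  + exact: iota_joinK.
  + exact: lambda_linesK.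
- apply: (set_bij_can2 (g := @iota_join X)).
  + exact: lambda_lines_structure.
  + exact: iota_join_equivalence.
  + exact: lambda_linesK.
  + exact: iota_joinK.
- exact: iota_joinK.
- exact: lambda_linesK.
- apply: (set_bij_can2 (g := @lambda_lines X)) => // L [] //.
  by move=> Lls _; apply: iota_joinK.
- apply: (set_bij_can2 (g := @iota_join X)) => // L [] //.
  by move=> Lls _; apply: iota_joinK.
Qed.
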